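(* Let $t,p$ be positive integers with $1\le p\le\lfloor\frac{t+5}{4}\rfloor$, let $N=t+3-2p$, and let $0<r_1<r_2<\dots<r_p$ be real numbers. Then the coherent configuration $\mathcal C_1$ on the tight Euclidean $t$-design $X=X_1\cup\dots\cup X_p\subset\mathbb R^2$, where $X_i=\{r_i(\cos\frac{(2k+i)\pi}{N},\sin\frac{(2k+i)\pi}{N})\mid 1\le k\le N\}$, is $P$-polynomial.
   Context: **Coherent configurations.** A coherent configuration is a pair $\mathcal C=(X,\mathcal R)$, where $X$ is a nonempty finite set and $\mathcal R=\{R_i\mid i\in I\}$ is a partition of $X\times X$ into nonempty sets such that: if $R_i$ meets $\operatorname{diag}(X\times X)=\{(x,x)\mid x\in X\}$ then $R_i\subseteq\operatorname{diag}(X\times X)$; the transpose of each $R_i$ is in $\mathcal R$; and for all $i,j,h\in I$ the number $|\{z\in X\mid (x,z)\in R_i,(z,y)\in R_j\}|$ does not depend on the choice of $(x,y)\in R_h$. The fibers $X_i$ ($i\in\Omega$) are the classes of the partition of $X$ determined by the relations contained in the diagonal; each relation is contained in a single $X_i\times X_j$. Put $\varepsilon_{i,j}=1-\delta_{i,j}$. The relations in $X_i\times X_j$ are numbered $R^{(i,j)}_\ell$, $\varepsilon_{i,j}\le\ell\le r_{i,j}$, with $R_0^{(i,i)}=\operatorname{diag}(X_i\times X_i)$ and with $R^{(j,i)}_\ell$ the transpose of $R^{(i,j)}_\ell$; put $\widetilde r_{i,j}=r_{i,j}-\varepsilon_{i,j}$. Let $A^{(i,j)}_\ell$ be the adjacency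 matrix of $R^{(i,j)}_\ell$ (indexed by $X\times X$, or equivalently, as a block, by $X_i\times X_j$), and $\mathcal A^{(i,j)}=\operatorname{span}_{\mathbb C}\{A_\ell^{(i,j)}\}$. **Eigenvalues.** One considers coherent configurations whose fibers carry symmetric association schemes and for which there are matrices $E_h^{(i,j)}$ ($i,j\in\Omega$, $0\le h\le\widetilde r_{i,j}$) such that: (B1) $E_0^{(i,j)}=\frac1{\sqrt{|X_i||X_j|}}J$ on the block $X_i\times X_j$ ($J$ all-ones); (B2) $\{E_h^{(i,j)}\}_{h}$ is a basis of $\mathcal A^{(i,j)}$; (B3) the transpose of $E_\ell^{(i,j)}$ is $E_\ell^{(j,i)}$; (B4) $E_\ell^{(i,j)}E_{\ell'}^{(i',j')}=\delta_{j,i'}\delta_{\ell,\ell'}E_\ell^{(i,j')}$. The eigenvalues $P_\ell^{(i,j)}(h)$ are defined by $A_\ell^{(i,j)}=\sum_{h=0}^{\widetilde r_{i,j}}P_\ell^{(i,j)}(h)E_h^{(i,j)}$. **$P$-polynomial.** Such a configuration is $P$-polynomial if for every $i,j\in\Omega$ there is an ordering $A^{(i,j)}_{\varepsilon_{i,j}},\dots,A^{(i,j)}_{r_{i,j}}$ of the adjacency matrices of the block (with $A_0^{(i,i)}$ the identity of $X_i$) such that $P^{(i,j)}_{\varepsilon_{i,j}}(h)\ne0$ for all $0\le h\le\widetilde r_{i,j}$ and, with $\overline{P_\ell^{(i,j)}}(h)=P_\ell^{(i,j)}(h)/P_{\varepsilon_{i,j}}^{(i,j)}(h)$, there are polynomials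 $v^{(i,j)}_\ell$ ($\varepsilon_{i,j}\le\ell\le r_{i,j}$) with $\deg v_\ell^{(i,j)}=\ell-\varepsilon_{i,j}$ and $\overline{P_\ell^{(i,j)}}(h)=v_\ell^{(i,j)}\bigl(\overline{P_{1+\varepsilon_{i,j}}^{(i,j)}}(h)\bigr)$ for all $0\le h\le\widetilde r_{i,j}$. (If $\widetilde r_{i,j}=0$ the polynomial condition is trivial.) **The configuration $\mathcal C_1$.** With $X_1,\dots,X_p$ as in the claim (these, with suitable weights, form Bajnok's tight Euclidean $t$-designs in $\mathbb R^2$), let $s_{i,j}$ be the number of values $\neq1$ of $\langle x,y\rangle/(r_ir_j)$ for $x\in X_i,y\in X_j$. Let $\xi_{i,j}=0$ if $i\equiv j\pmod 2$ and $\xi_{i,j}=1$ otherwise. Let $r_{i,j}=s_{i,j}+1$ if $i\ne j$ and $i\equiv j\pmod2$, and $r_{i,j}=s_{i,j}$ otherwise. For $\varepsilon_{i,j}\le\ell\le r_{i,j}$ let $\alpha_\ell^{(i,j)}=\cos\frac{(2(\ell-\varepsilon_{i,j})+\xi_{i,j})\pi}{N}$ and $R_\ell^{(i,j)}=\{(x,y)\in X_i\times X_j\mid \langle x,y\rangle/(r_ir_j)=\alpha_\ell^{(i,j)}\}$. Then $\mathcal C_1=(X,\{R_\ell^{(i,j)}\})$, with fibers $X_1,\dots,X_p$; it is a coherent configuration whose fibers carry symmetric association schemes and which admits matrices $E_h^{(i,j)}$ ($1\le i,j\le p$, $0\le h\le\widetilde r_{i,j}$) such that $E_0^{(i,j)}=\frac1{\sqrt{|X_i||X_j|}}J$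 on the block $X_i\times X_j$, $\{E_h^{(i,j)}\}_h$ is a basis of $\mathcal A^{(i,j)}$, the transpose of $E_\ell^{(i,j)}$ is $E_\ell^{(j,i)}$, and $E_\ell^{(i,j)}E_{\ell'}^{(i',j')}=\delta_{j,i'}\delta_{\ell,\ell'}E_\ell^{(i,j')}$. *)

(* Defs.v *)
From mathcomp Require Import all_boot all_order all_algebra finmap.
From mathcomp Require Import reals trigo.
From mathcomp.real_closed Require Import complex.

Set Implicit Arguments.
Unset Strict Implicit.
Unset Printing Implicit Defensive.

Import Order.TTheory GRing.Theory Num.Theory.

Local Open Scope ring_scope.
Local Open Scope complex_scope.

Definition diagonal (X : finType) (F : {set X}) : {set X * X} :=
  [set (x, x) | x in F].

Definition transpose (X : finType) (Q : {set X * X}) : {set X * X} :=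
  [set (xy.2, xy.1) | xy in Q].

Definition intersection_number (X : finType) (Q1 Q2 : {set X * X}) (x y : X)
    : nat :=
  #|[set z | ((x, z) \in Q1) && ((z, y) \in Q2)]|.

Definition coherent_configuration (X : finType) (Rs : {set {set X * X}})
    : Prop :=
  [/\ (0 < #|X|)%N,
      partition Rs [set: X * X],
      forall Q, Q \in Rs -> Q :&: diagonal [set: X] != set0 ->
        Q \subset diagonal [set: X],
      forall Q, Q \in Rs -> transpose Q \in Rs &
      forall Q1 Q2 Q3, Q1 \in Rs -> Q2 \in Rs -> Q3 \in Rs ->
      forall x y x' y', (x, y) \in Q3 -> (x', y') \in Q3 ->
        intersection_number Q1 Q2 x y = intersection_number Q1 Q2 x' y'].

Definition fibers (X : finType) (Rs : {set {set X * X}}) : {set {set X}} :=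
  [set [set x : X | (x, x) \in Q] | Q : {set X * X} in Rs & Q \subset diagonal [set: X]].

(* Fibers indexed by Omega, and relations R_l^(i,j); only the labels
   eps i j <= l <= rmax i j are meaningful. *)
Record labelling (Omega X : finType) := Labelling {
  fiber : Omega -> {set X};
  rmax : Omega -> Omega -> nat;
  rel_of : Omega -> Omega -> nat -> {set X * X}
}.

Definition eps (Omega : finType) (i j : Omega) : nat := i != j.

Definition is_label (Omega X : finType) (c : labelling Omega X)
    (i j : Omega) (l : nat) : bool :=
  (eps i j <= l <= rmax c i j)%N.

Definition labels (Omega X : finType) (c : labelling Omega X)
    (i j : Omega) : seq nat :=
  iota (eps i j) ((rmax c i j).+1 - eps i j).

Definition rtilde (Omega X : finType) (c : labelling Omega X)
    (i j : Omega) : nat :=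
  (rmax c i j - eps i j)%N.

Definition relations (Omega X : finType) (c : labelling Omega X)
    : {set {set X * X}} :=
  [set Q | [exists i, exists j, Q \in [seq rel_of c i j l | l <- labels c i j]]].

Definition labelled_coherent_configuration (Omega X : finType)
    (c : labelling Omega X) : Prop :=
  coherent_configuration (relations c) /\
  [/\ injective (fiber c) /\ fibers (relations c) = [set fiber c i | i : Omega],
      forall i j l i' j' l', is_label c i j l -> is_label c i' j' l' ->
        rel_of c i j l = rel_of c i' j' l' -> [/\ i = i', j = j' & l = l'],
      forall i j l, is_label c i j l ->
        rel_of c i j l \subset setX (fiber c i) (fiber c j),
      forall i, rel_of c i i 0 = diagonal (fiber c i) &
      forall i j l, is_label c i j l ->
        is_label c j i l /\ rel_of c j i l = transpose (rel_of c i j l)].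

(* In a coherent configuration the relations inside one fiber always form an
   association scheme, so only their symmetry has to be required. *)
Definition symmetric_fibers (Omega X : finType) (c : labelling Omega X) : Prop :=
  forall i l, is_label c i i l ->
    transpose (rel_of c i i l) = rel_of c i i l.

(* Matrices indexed by X x X are indexed by 'I_#|X| through enum_val. *)
Definition adjacency (R : rcfType) (X : finType) (Q : {set X * X})
    : 'M[R[i]]_#|X| :=
  \matrix_(a, b) ((enum_val a, enum_val b) \in Q)%:R.

Definition adj (R : rcfType) (Omega X : finType) (c : labelling Omega X)
    (i j : Omega) (l : nat) : 'M[R[i]]_#|X| :=
  adjacency R (rel_of c i j l).

(* The matrices E_h^(i,j), 0 <= h <= rtilde i j; the first clause only fixes the
   value of the total function E outside this range. *)
Definition idempotent_basis (R : rcfType) (Omega X : finType)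
    (c : labelling Omega X) (E : Omega -> Omega -> nat -> 'M[R[i]]_#|X|)
    : Prop :=
  [/\ forall i j h, (rtilde c i j < h)%N -> E i j h = 0,
      forall i j, E i j 0%N =
        ((Num.sqrt (#|fiber c i| * #|fiber c j|)%:R)^-1)%:C
          *: adjacency R (setX (fiber c i) (fiber c j)),
      forall i j, basis_of <<[seq adj R c i j l | l <- labels c i j]>>%VS
                           [seq E i j h | h <- iota 0 (rtilde c i j).+1],
      forall i j h, (h <= rtilde c i j)%N -> (E i j h)^T = E j i h &
      forall i j h i' j' h', (h <= rtilde c i j)%N -> (h' <= rtilde c i' j')%N ->
        E i j h *m E i' j' h' =
          if (j == i') && (h == h') then E i j' h else 0].

(* P i j l h stands for P_l^(i,j)(h). *)
Definition eigenvalues (R : rcfType) (Omega X : finType) (c : labelling Omega X)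
    (E : Omega -> Omega -> nat -> 'M[R[i]]_#|X|)
    (P : Omega -> Omega -> nat -> nat -> R[i]) : Prop :=
  forall i j l, is_label c i j l ->
    adj R c i j l = \sum_(0 <= h < (rtilde c i j).+1) P i j l h *: E i j h.

(* The ordering of the block (i,j) is the permutation o of its labels: the l-th
   matrix is A_(o l)^(i,j). When rtilde c i j = 0 the only label is eps i j and
   the value at the label (eps i j).+1 plays no role, as v is then constant. *)
Definition P_polynomial_block (R : rcfType) (Omega X : finType)
    (c : labelling Omega X) (P : Omega -> Omega -> nat -> nat -> R[i])
    (i j : Omega) : Prop :=
  exists o : nat -> nat,
    let e := eps i j in
    let Pbar l h := P i j (o l) h / P i j (o e) h in
    [/\ perm_eq (map o (labels c i j)) (labels c i j),
        i = j -> o 0%N = 0%N,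
        forall h, (h <= rtilde c i j)%N -> P i j (o e) h != 0 &
        exists v : nat -> {poly R[i]},
          forall l, is_label c i j l ->
            size (v l) = (l - e).+1 /\
            forall h, (h <= rtilde c i j)%N ->
              Pbar l h = (v l).[Pbar e.+1 h]].

(* The matrices E_h^(i,j) are determined by c up to renumbering h and up to
   signs, neither of which affects the polynomial condition; it is therefore
   required of every choice, together with the existence of one. *)
Definition P_polynomial (R : rcfType) (Omega X : finType)
    (c : labelling Omega X) : Prop :=
  [/\ labelled_coherent_configuration c,
      symmetric_fibers c,
      exists E, idempotent_basis (R := R) c E &
      forall E P, idempotent_basis (R := R) c E -> eigenvalues c E P ->
        forall i j, P_polynomial_block c P i j].

Definition inner (R : realType) (x y : 'rV[R]_2) : R :=
  \sum_(k < 2) x 0 k * y 0 k.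

Definition circle_point (R : realType) (rho theta : R) : 'rV[R]_2 :=
  rho *: \row_(k < 2) (if k == 0 then cos theta else sin theta).

Section Bajnok.
Context (R : realType) (p N : nat) (r : 'I_p -> R).

(* The index i : 'I_p stands for the index i.+1 of X_1, ..., X_p. *)
Definition bajnok_fiber (i : 'I_p) : {fset 'rV[R]_2} :=
  [fset circle_point (r i) (((2 * k + i.+1)%:R * pi) / N%:R)
     | k in iota 1 N]%fset.

Definition bajnok_points : {fset 'rV[R]_2} :=
  (\bigcup_(i <- enum 'I_p) bajnok_fiber i)%fset.

Definition cosine (i j : 'I_p) (x y : 'rV[R]_2) : R := inner x y / (r i * r j).

Definition bajnok_s (i j : 'I_p) : nat :=
  #|` [fset cosine i j x y | x in bajnok_fiber i, y in bajnok_fiber j]%fset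
      `\ 1%R|%fset.

Definition xi (i j : 'I_p) : nat := odd i.+1 != odd j.+1.

Definition bajnok_rmax (i j : 'I_p) : nat :=
  if (i != j) && (xi i j == 0%N) then (bajnok_s i j).+1 else bajnok_s i j.

Definition bajnok_alpha (i j : 'I_p) (l : nat) : R :=
  cos ((2 * (l - eps i j) + xi i j)%:R * pi / N%:R).

Definition bajnok_configuration : labelling 'I_p bajnok_points :=
  {| fiber i := [set x | val x \in bajnok_fiber i];
     rmax := bajnok_rmax;
     rel_of i j l :=
       [set xy | [&& val xy.1 \in bajnok_fiber i, val xy.2 \in bajnok_fiber j &
                     cosine i j (val xy.1) (val xy.2) == bajnok_alpha i j l]] |}.

End Bajnok.

(* Main.v *)
Require Import Defs.
From mathcomp Require Import all_boot all_order all_algebra finmap.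
From mathcomp Require Import reals trigo.
From mathcomp Require Import zify ring lra.
From mathcomp.real_closed Require Import complex.

Set Implicit Arguments.
Unset Strict Implicit.
Unset Printing Implicit Defensive.

Import Order.TTheory GRing.Theory Num.Theory.

Local Open Scope ring_scope.

(** Measure angles in units of pi/N. A point of the design is then a pair
(i, k), at the integer angle 2k + i, and whether a pair of X_i x X_j lies in
a given relation depends only on its gap, the difference of the two angles,
taken up to sign and modulo 2N. All gaps of the block (i, j) have the parity
xi of i - j, so that the labels of the block correspond to the integers
2m + xi between 0 and N; hence the block has (N - xi)/2 + 1 relations
([rmaxE]).

Coherence. The rotations by even angles and the reflection composed with them
preserve every X_i and are transitive on every relation, so that intersection
numbers are constant on relations ([intersection_number_const]).

Basis. On pairs of gap d, let E_h be w_h / N * cos(h d pi / N), the zonal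
kernel of degree h, where w_h is 1 for h = 0 and h = N/2 and is 2 otherwise.
The product rule is the orthogonality of characters of Z/N
([zonal_conv]), and E_h is a combination of adjacency matrices because
cos(h d pi / N) is determined by cos(d pi / N). When N is even, the kernel of
degree N/2 vanishes at odd gaps, in agreement with the smaller number of
relations in the blocks of odd gaps.

P-polynomiality. The argument applies to every choice of the matrices E_h. Let
B_u be the block (i, j) of T^u + T^(-u), where T is the rotation by one unit;
it is once or twice an adjacency matrix. Then
  B_u^(i,j) B_2^(j,j) = B_(u+2)^(i,j) + B_(u-2)^(i,j)     ([rot_pair_mul]).
On E_h this becomes b_(m+1) = g b_m - b_(m-1), where b_m and g are the
eigenvalues of B_(2m+xi)^(i,j) and B_2^(j,j). The recurrence starts at
B_(xi-2), which is B_2 for xi = 0 and B_1 for xi = 1, so that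
b_1 = (g - xi)/(2 - xi) b_0. Thus b_m = u_m(g) b_0 with u_m of degree m
([three_term_eval]). If b_0 were 0 then E_h would be annihilated by the whole
block ([eigenvalues_neq0]); so b_0 is nonzero and b_m / b_0 = u_m(g). Since
b_1 / b_0 is an affine function of g, substituting expresses every
b_m / b_0 as a polynomial of degree m in b_1 / b_0. *)

(** * Cosines of multiples of pi/N *)

Section Periodic.
Variable N : nat.
Hypothesis N_gt0 : (0 < N)%N.

Lemma periodicM (T : Type) (d : int) (F : int -> T) :
  (forall a, F (a + d) = F a) -> forall a q, F (a + q * d) = F a.
Proof.
move=> FN a q; have pos m b : F (b + m%:Z * d) = F b.
  elim: m b => [|m IH] b; first by rewrite mul0r addr0.
  by rewrite intS mulrDl mul1r addrA IH FN.
case: (intP q) => [|m|m]; first by rewrite mul0r addr0.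
  by rewrite pos.
by rewrite mulNr -[LHS](pos m.+1) subrK.
Qed.

(** Full turns and the reflection a |-> -a move every angle into [0, pi], where
the cosine is injective. *)
Lemma int_fold (a : int) : exists n : nat, exists q : int, (n <= N)%N /\
  (a = n%:Z + q * (2 * N)%:Z \/ a = - n%:Z + q * (2 * N)%:Z).
Proof.
have M_gt0 : 0 < (2 * N)%:Z by lia.
have := modz_ge0 a (lt0r_neq0 M_gt0); have := ltz_pmod a M_gt0.
move: (divz_eq a (2 * N)%:Z); move: (a %/ _)%Z (a %% _)%Z => q [] // n eqa nM _.
have [nN|nN] := leqP n N; first by exists n, q; split=> //; left; rewrite addrC.
exists (2 * N - n)%N, (q + 1); split; first lia.
by right; rewrite mulrDl mul1r; lia.
Qed.

Variables (V : nmodType) (F : int -> V).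
Hypothesis FN : forall a, F (a + N%:Z) = F a.

Lemma sum_periodic_shift m :
  \sum_(k < N) F (k%:Z + m) = \sum_(k < N) F k%:Z.
Proof.
have shift1 G : (forall a, G (a + N%:Z) = G a) ->
    \sum_(k < N) G (k%:Z + 1) = \sum_(k < N) G k%:Z :> V.
  move=> GN; case: N N_gt0 GN => // n _ GN.
  rewrite big_ord_recr big_ord_recl /= addrC; congr (_ + _).
    by rewrite -[RHS]GN; congr G; lia.
  by apply: eq_bigr => k _; congr G; rewrite /bump /=; lia.
have pos n : forall G, (forall a, G (a + N%:Z) = G a) ->
    \sum_(k < N) G (k%:Z + n%:Z) = \sum_(k < N) G k%:Z :> V.
  elim: n => [|n IH] G GN; first by apply: eq_bigr => k _; rewrite addr0.
  rewrite -(IH G GN) -(shift1 (fun a => G (a + n%:Z))) => [|a].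
    by apply: eq_bigr => k _; congr G; lia.
  by rewrite addrAC GN.
have -> : m = (m %% N%:Z)%Z + (m %/ N%:Z)%Z * N%:Z by rewrite addrC -divz_eq.
under eq_bigr do rewrite addrA (periodicM FN).
have /pos : forall a, F (a + N%:Z) = F a by [].
have : 0 <= (m %% N%:Z)%Z by rewrite modz_ge0 //; lia.
by case: (_ %% _)%Z => // n _; apply.
Qed.

Lemma sum_periodic_opp : \sum_(k < N) F (- k%:Z) = \sum_(k < N) F k%:Z.
Proof.
rewrite -[RHS](sum_periodic_shift 1) [RHS](reindex_inj rev_ord_inj) /=.
apply: eq_bigr => k _; rewrite -[LHS]FN; congr F; have := ltn_ord k; lia.
Qed.

End Periodic.

Section Cosines.
Variables (R : realType) (N : nat).
Hypothesis N_gt0 : (0 < N)%N.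

Definition cosn (a : int) : R := cos (a%:~R * pi / N%:R).

Let Nr : N%:R != 0 :> R.
Proof. by rewrite pnatr_eq0 -lt0n. Qed.

Lemma cosn0 : cosn 0 = 1.
Proof. by rewrite /cosn !mul0r cos0. Qed.

Lemma cosnN a : cosn (- a) = cosn a.
Proof. by rewrite /cosn mulrNz !mulNr cosN. Qed.

Lemma cosnM a b : cosn a * cosn b = (cosn (a + b) + cosn (a - b)) / 2.
Proof.
rewrite /cosn intrD intrB !mulrDl cosD !mulNr cosB.
by field.
Qed.

Lemma cosnDN a : cosn (a + N%:Z) = - cosn a.
Proof.
rewrite /cosn intrD mulrDl mulrDl -cosDpi; congr (cos (_ + _)).
by rewrite mulrAC -pmulrn divff // mul1r.
Qed.

Lemma cosnD2N a : cosn (a + (2 * N)%:Z) = cosn a.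
Proof.
have -> : (2 * N)%:Z = N%:Z + N%:Z by lia.
by rewrite addrA !cosnDN opprK.
Qed.

Lemma cosn_per a q : cosn (a + q * (2 * N)%:Z) = cosn a.
Proof. exact/periodicM/cosnD2N. Qed.

Lemma cosn_inj n m : (n <= N)%N -> (m <= N)%N -> cosn n%:Z = cosn m%:Z -> n = m.
Proof.
have in0pi k : (k <= N)%N -> k%:R * pi / N%:R \in `[0, pi : R].
  move=> kN; rewrite in_itv /= divr_ge0 ?mulr_ge0 ?pi_ge0 ?ler0n //=.
  by rewrite ler_pdivrMr ?ltr0n // mulrC ler_wpM2l ?pi_ge0 ?ler_nat.
move=> nN mN /cos_inj; rewrite !in0pi // => /(_ isT isT) /(mulIf (invr_neq0 Nr)).
move/(mulIf (lt0r_neq0 (pi_gt0 R))) => /eqP; rewrite -!pmulrn eqr_nat.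
by move/eqP.
Qed.

Lemma cosnP a b : cosn a = cosn b <->
  exists q : int, a = b + q * (2 * N)%:Z \/ a = - b + q * (2 * N)%:Z.
Proof.
split=> [|[q [|] ->]]; rewrite ?cosn_per ?cosnN //.
have [n [q [nN eqa]]] := int_fold N_gt0 a; have [m [s [mN eqb]]] := int_fold N_gt0 b.
have -> : cosn a = cosn n%:Z by case: eqa => ->; rewrite cosn_per ?cosnN.
have -> : cosn b = cosn m%:Z by case: eqb => ->; rewrite cosn_per ?cosnN.
move=> /(cosn_inj nN mN) eqnm; subst m.
case: eqa eqb => -> [|] ->.
- by exists (q - s); left; ring.
- by exists (q + s); right; ring.
- by exists (q + s); right; ring.
- by exists (q - s); left; ring.
Qed.

(** This is the Chebyshev relation: cos(h x) is a function of cos x. *)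
Lemma cosn_scale (h a b : int) : cosn a = cosn b -> cosn (h * a) = cosn (h * b).
Proof.
move/cosnP=> [q [|] ->]; apply/cosnP; exists (h * q); first by left; ring.
by right; ring.
Qed.

(** The sum S is unchanged when k is replaced by k + 1 or k - 1; adding the two
shifted sums gives 2 S = 2 cos(2 m pi / N) S, and the cosine is not 1. *)
Lemma sum_cosn (m d : int) : ~~ (N%:Z %| m)%Z ->
  \sum_(k < N) cosn (2 * m * k%:Z + d) = 0.
Proof.
move=> Ndvd; set S := \sum_(k < N) _.
pose F (b a : int) := cosn (2 * m * a + d + b).
have FN b a : F b (a + N%:Z) = F b a.
  by rewrite /F -[RHS](cosn_per _ m); congr cosn; rewrite PoszM; ring.
have shiftS e : \sum_(k < N) cosn (2 * m * k%:Z + d + e * (2 * m)) = S.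
  rewrite /S -(sum_periodic_shift N_gt0 (FN (e * (2 * m))) (- e)).
  by apply: eq_bigr => k _; rewrite /F; congr cosn; ring.
have : S + S = 2 * cosn (2 * m) * S.
  rewrite -{1}(shiftS 1) -{1}(shiftS (-1)) -big_split mulr_sumr /=.
  apply: eq_bigr => k _; rewrite -[RHS]mulrA cosnM [2 * m + _]addrC.
  rewrite -(cosnN (2 * m - _)) mulN1r mul1r opprB.
  by rewrite [RHS]mulrC divfK ?pnatr_eq0.
move=> eqS; apply/eqP.
have : (1 - cosn (2 * m)) * S == 0.
  by apply/eqP; lra.
rewrite mulf_eq0 => /orP[|//]; rewrite subr_eq0 -cosn0 => /eqP/cosnP [q eq2m].
by case/negP: Ndvd; apply/dvdzP; case: eq2m => ?; [exists (- q) | exists q]; lia.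
Qed.

End Cosines.

(** * Coordinates on the design *)

Section Points.
Variables (R : realType) (p N : nat) (r : 'I_p -> R).
Local Notation X := (bajnok_points N r).
Local Notation cosN := (@cosn R N).

Lemma inner_circle_point (rho rho' s t : R) :
  inner (circle_point rho s) (circle_point rho' t) = rho * rho' * cos (s - t).
Proof.
rewrite /inner big_ord_recl big_ord1 /circle_point !mxE /= cosB; ring.
Qed.

(** Ordinals start at 0, whereas the fibers and the points of a fiber are
numbered from 1. *)
Definition angle_index (ik : 'I_p * 'I_N) : nat := 2 * ik.2.+1 + ik.1.+1.

Definition bajnok_vector ik : 'rV[R]_2 :=
  circle_point (r ik.1) ((angle_index ik)%:R * pi / N%:R).

Lemma bajnok_fiberP i v :
  reflect (exists k, v = bajnok_vector (i, k)) (v \in bajnok_fiber N r i).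
Proof.
apply: (iffP (imfsetP _ _ _ _)) => [[m /= mN ->]|[k ->]].
  rewrite mem_iota in mN; have mN1 : (m.-1 < N)%N by lia.
  exists (Ordinal mN1); rewrite /bajnok_vector /angle_index /=.
  by rewrite prednK //; lia.
by exists k.+1 => //=; rewrite mem_iota; have := ltn_ord k; lia.
Qed.

Lemma bajnok_vector_in ik : bajnok_vector ik \in X.
Proof.
apply/bigfcupP; exists ik.1; first by rewrite mem_enum.
by apply/bajnok_fiberP; exists ik.2; case: ik.
Qed.

Definition bajnok_point ik : X := [` bajnok_vector_in ik]%fset.

(** Stated as an existence, so that the choice of coordinates is opaque to
conversion. *)
Lemma coordinates_sig : {f : X -> 'I_p * 'I_N | cancel f bajnok_point}.
Proof.
have surj (x : X) : exists ik, bajnok_point ik == x.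
  have /bigfcupP[i _ /bajnok_fiberP[k eqx]] := valP x.
  by exists (i, k); apply/eqP/val_inj.
by exists (fun x => xchoose (surj x)) => x; apply/eqP/(xchooseP (surj x)).
Qed.

Definition coordinates : X -> 'I_p * 'I_N := sval coordinates_sig.
Definition fiber_index (x : X) : 'I_p := (coordinates x).1.
Definition angle (x : X) : int := angle_index (coordinates x).

Lemma coordinatesK : cancel coordinates bajnok_point.
Proof. exact: svalP coordinates_sig. Qed.

Lemma bajnok_vectorE x : val x = bajnok_vector (coordinates x).
Proof. by rewrite -{1}(coordinatesK x). Qed.

Lemma angle_parity x : exists k : int, angle x = 2 * k + (fiber_index x).+1%:Z.
Proof.
rewrite /angle /fiber_index; case: (coordinates x) => i k.
by exists k.+1%:Z; rewrite /angle_index /=; lia.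
Qed.

Hypotheses (N_gt1 : (1 < N)%N) (r_gt0 : forall i, 0 < r i) (r_inj : injective r).

Let N_gt0 : (0 < N)%N. Proof. exact: ltnW. Qed.

Lemma cosine_circle_point i j (a b : nat) :
  cosine r i j (circle_point (r i) (a%:R * pi / N%:R))
               (circle_point (r j) (b%:R * pi / N%:R)) = cosN (a%:Z - b%:Z).
Proof.
rewrite /cosine inner_circle_point mulrC mulKf; last first.
  by rewrite mulf_neq0 ?lt0r_neq0.
by rewrite /cosn intrB !mulrBl.
Qed.

Lemma angle_index_inj i k l :
  cosN ((angle_index (i, k))%:Z - (angle_index (i, l))%:Z) = 1 -> k = l.
Proof.
rewrite -(cosn0 R N) => /(cosnP R N_gt0)[q eqa]; apply/val_inj/eqP => /=.
have : k%:Z - l%:Z = q * N%:Z.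
  by case: eqa; rewrite /angle_index /= ?oppr0 ?add0r; lia.
have := ltn_ord k; have := ltn_ord l; case: (intP q) => [|m|m]; nia.
Qed.

(** The norm of a point determines its circle, because the radii are
distinct; its angle is then determined modulo a full turn. *)
Lemma bajnok_vector_inj : injective bajnok_vector.
Proof.
move=> [i k] [j l] eqv.
have inner_self i' k' :
    inner (bajnok_vector (i', k')) (bajnok_vector (i', k')) = r i' ^+ 2.
  by rewrite inner_circle_point subrr cos0 mulr1.
have eqij : i = j.
  apply: r_inj; apply/eqP; rewrite -(@eqrXn2 _ 2) ?ltW //.
  by rewrite -(inner_self i k) eqv inner_self.
subst j; congr (_, _).
apply: (@angle_index_inj i).
rewrite -[RHS](_ : cosine r i i (bajnok_vector (i, k)) (bajnok_vector (i, k)) = 1).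
  by rewrite {2}eqv cosine_circle_point.
by rewrite cosine_circle_point subrr cosn0.
Qed.

Lemma bajnok_pointK : cancel bajnok_point coordinates.
Proof.
move=> ik; apply: bajnok_vector_inj.
exact: (congr1 val (coordinatesK (bajnok_point ik))).
Qed.

Lemma mem_bajnok_fiber i x : (val x \in bajnok_fiber N r i) = (fiber_index x == i).
Proof.
rewrite bajnok_vectorE /fiber_index; case: (coordinates x) => j k.
apply/bajnok_fiberP/eqP => [[l /bajnok_vector_inj[->]]//|/= <-].
by exists k.
Qed.

Lemma cosine_bajnok x y :
  cosine r (fiber_index x) (fiber_index y) (val x) (val y) =
  cosN (angle x - angle y).
Proof. by rewrite !bajnok_vectorE cosine_circle_point. Qed.

(** The angles of a fiber run through one residue class modulo 2 of the
integers modulo 2N. *)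
Lemma sum_fiber (V : nmodType) (G : int -> V) j :
  (forall a, G (a + (2 * N)%:Z) = G a) ->
  \sum_(z : X | fiber_index z == j) G (angle z) =
  \sum_(k < N) G (2 * k%:Z + j.+1%:Z).
Proof.
move=> GN; rewrite (reindex_onto (fun k => bajnok_point (j, k))
                      (fun z => (coordinates z).2)) /=; last first.
  by move=> z /eqP <-; rewrite -surjective_pairing coordinatesK.
under eq_bigl do rewrite /fiber_index bajnok_pointK !eqxx.
pose F (k : int) := G (2 * k + j.+1%:Z).
have FN k : F (k + N%:Z) = F k by rewrite /F -[RHS]GN; congr G; lia.
rewrite -(sum_periodic_shift N_gt0 FN 1); apply: eq_bigr => k _.
by rewrite /F /angle bajnok_pointK /angle_index /=; congr G; lia.
Qed.

Lemma angle_inj x y : fiber_index x = fiber_index y ->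
  cosN (angle x - angle y) = 1 -> x = y.
Proof.
rewrite -{3}(coordinatesK x) -{3}(coordinatesK y) /fiber_index /angle.
case: (coordinates x) (coordinates y) => [i k] [j l] /= <-.
by move/(@angle_index_inj i) => ->.
Qed.

Lemma angle_surj i (k : int) : exists2 x, fiber_index x = i &
  exists q : int, angle x = 2 * k + i.+1%:Z + q * (2 * N)%:Z.
Proof.
have N0 : 0 < N%:Z by lia.
move: (divz_eq (k - 1) N) (modz_ge0 (k - 1) (lt0r_neq0 N0)) (ltz_pmod (k - 1) N0).
move: (_ %/ _)%Z (_ %% _)%Z => q [] // m eqk _ mN.
exists (bajnok_point (i, Ordinal (mN : (m < N)%N))).
  by rewrite /fiber_index bajnok_pointK.
by exists (- q); rewrite /angle bajnok_pointK /angle_index /=; lia.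
Qed.

End Points.

(** * Gaps and the number of relations *)

Lemma card_fset_map (K : choiceType) (A : {fset K}) (f : nat -> K) (s : seq nat) :
  uniq s -> {in s &, injective f} -> A =i map f s -> #|` A|%fset = size s.
Proof.
move=> us fs As; rewrite -(size_map f); apply/perm_size/uniq_perm => //.
by rewrite map_inj_in_uniq.
Qed.

Section Config.
Variables (R : realType) (p N : nat) (r : 'I_p -> R).
Hypotheses (N_gt1 : (1 < N)%N) (r_gt0 : forall i, 0 < r i) (r_inj : injective r).

Let N_gt0 : (0 < N)%N. Proof. exact: ltnW. Qed.
Local Notation X := (bajnok_points N r).
Local Notation c := (bajnok_configuration N r).
Local Notation cosN := (@cosn R N).
Local Notation deg i j := ((N - xi i j)./2).

Implicit Types (i j : 'I_p) (x y z : X).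

Lemma xi_le1 i j : (xi i j <= 1)%N.
Proof. by rewrite /xi; case: (_ != _). Qed.

Lemma xiC i j : xi i j = xi j i.
Proof. by rewrite /xi eq_sym. Qed.

Lemma xi_ii i : xi i i = 0%N.
Proof. by rewrite /xi eqxx. Qed.

Lemma epsC i j : eps i j = eps j i.
Proof. by rewrite /eps eq_sym. Qed.

Definition angle_gap i j (m : nat) : int := (2 * m + xi i j)%:Z.

Lemma gap_inj i j m n : (m <= deg i j)%N -> (n <= deg i j)%N ->
  cosN (angle_gap i j m) = cosN (angle_gap i j n) -> m = n.
Proof.
move=> mN nN; have := xi_le1 i j => ?.
move=> eqc; suff : (2 * m + xi i j = 2 * n + xi i j)%N by lia.
by apply: (cosn_inj N_gt0 _ _ eqc); lia.
Qed.

(** The gaps of the block (i, j) have the parity of i - j, which is that of xi;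
folding into [0, N] preserves parity because 2N is even. *)
Lemma gap_fold x y : exists2 m, (m <= deg (fiber_index x) (fiber_index y))%N &
  cosN (angle x - angle y) = cosN (angle_gap (fiber_index x) (fiber_index y) m).
Proof.
have [k ->] := angle_parity x; have [l ->] := angle_parity y.
move: (fiber_index x) (fiber_index y) => i j.
set a : int := (Z in cosN Z).
have [n [q [nN eqa]]] := int_fold N_gt0 a.
have parn : odd n = odd (xi i j).
  have : xi i j = (odd i.+1 (+) odd j.+1) :> nat by rewrite /xi; do 2!case: odd.
  by move: eqa; rewrite /a; case; lia.
exists n./2; first by have := xi_le1 i j; lia.
have -> : angle_gap i j n./2 = n%:Z by rewrite /angle_gap; have := xi_le1 i j; lia.
by case: eqa => ->; rewrite cosn_per ?cosnN.
Qed.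

Lemma gap_surj y i m :
  exists2 x : X, fiber_index x = i &
    cosN (angle x - angle y) = cosN (angle_gap i (fiber_index y) m).
Proof.
have [l eqy] := angle_parity y; set j := fiber_index y in eqy *.
have [k eqk] : exists k : int, angle_gap i j m + angle y = 2 * k + i.+1%:Z.
  have : xi i j = (odd i.+1 (+) odd j.+1) :> nat by rewrite /xi; do 2!case: odd.
  exists ((angle_gap i j m + angle y - i.+1%:Z) %/ 2)%Z.
  by rewrite eqy /angle_gap; lia.
have [x fx [q eqx]] := angle_surj N_gt1 r_gt0 r_inj i k.
exists x => //; rewrite eqx -eqk -(cosn_per R N_gt0 (angle_gap i j m) q).
by congr cosn; ring.
Qed.

Lemma fiber_inhabited i : exists x : X, fiber_index x = i.
Proof. by have [x fx _] := angle_surj N_gt1 r_gt0 r_inj i 0; exists x. Qed.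

Lemma cosine_valuesP i j v :
  reflect (exists2 m, (m <= deg i j)%N & v = cosN (angle_gap i j m))
    (v \in [fset cosine r i j x y | x in bajnok_fiber N r i,
                                   y in bajnok_fiber N r j]%fset).
Proof.
apply: (iffP (imfset2P _ _ _ _ _)) => [[u /= ui [w /= wj ->]]|[m mN ->]].
  have inX k t : t \in bajnok_fiber N r k -> t \in X.
    by move=> tk; apply/bigfcupP; exists k; rewrite ?mem_enum.
  pose x : X := [` inX _ _ ui]%fset; pose y : X := [` inX _ _ wj]%fset.
  have /eqP fx : fiber_index x == i by rewrite -mem_bajnok_fiber.
  have /eqP fy : fiber_index y == j by rewrite -mem_bajnok_fiber.
  have [m mN eqm] := gap_fold x y; rewrite fx fy in mN eqm.
  by exists m => //; rewrite -eqm -cosine_bajnok // fx fy.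
have [y fy] := fiber_inhabited j; have [x fx eqm] := gap_surj y i m.
exists (val x); first by rewrite /= mem_bajnok_fiber // fx.
exists (val y); first by rewrite /= mem_bajnok_fiber // fy.
by rewrite -fy -eqm -cosine_bajnok // fx.
Qed.

(** The gap 0 has cosine 1, so that for xi = 0 the count of cosines other than
1 misses it. Labels off the diagonal start at 1, and this is what the extra
unit in the number of relations compensates for; for xi = 1 no gap has
cosine 1. *)
Lemma rmaxE i j : bajnok_rmax N r i j = (eps i j + deg i j)%N.
Proof.
rewrite /bajnok_rmax; have [xi0|xi1] := eqVneq (xi i j) 0%N.
  suff -> : bajnok_s N r i j = N./2.
    by rewrite xi0 subn0 andbT /eps; case: (i == j).
  rewrite -[RHS](size_iota 1).
  apply: (card_fset_map (f := fun m => cosN (angle_gap i j m))).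
  - exact: iota_uniq.
  - by move=> m n; rewrite !mem_iota => mN nN; apply: gap_inj; rewrite xi0; lia.
  move=> v; rewrite in_fsetD1.
  apply/andP/mapP => [[v1 /cosine_valuesP[m mN eqv]]|[m mN ->]].
    exists m => //; rewrite mem_iota; rewrite xi0 in mN.
    case: m mN eqv => [|m] mN eqv; last lia.
    by case/eqP: v1; rewrite eqv /angle_gap xi0 cosn0.
  rewrite mem_iota in mN; split; last first.
    by apply/cosine_valuesP; exists m => //; rewrite xi0; lia.
  apply/eqP; rewrite -(cosn0 R N); move=> eq0.
  suff : m = 0%N by lia.
  by apply: (@gap_inj i j); rewrite ?xi0 //; [lia | rewrite eq0 /angle_gap xi0].
have xi1' : xi i j = 1%N by have := xi_le1 i j; lia.
have ij : i != j by apply: contraNneq xi1 => ->; rewrite xi_ii.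
rewrite andbF /eps ij -[RHS](size_iota 0).
apply: (card_fset_map (f := fun m => cosN (angle_gap i j m))).
- exact: iota_uniq.
- by move=> m n; rewrite !mem_iota => mN nN; apply: gap_inj; lia.
move=> v; rewrite in_fsetD1.
apply/andP/mapP => [[_ /cosine_valuesP[m mN eqv]]|[m mN ->]].
  by exists m => //; rewrite mem_iota; lia.
rewrite mem_iota in mN; split; last by apply/cosine_valuesP; exists m => //; lia.
apply/eqP; rewrite -(cosn0 R N) /angle_gap xi1' => /(cosnP R N_gt0)[q].
by case; lia.
Qed.

Lemma rtildeE i j : rtilde c i j = deg i j.
Proof. by rewrite /rtilde /= rmaxE addKn. Qed.

Lemma rtildeC i j : rtilde c i j = rtilde c j i.
Proof. by rewrite !rtildeE xiC. Qed.

Lemma labelP i j l :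
  is_label c i j l = (eps i j <= l)%N && (l - eps i j <= rtilde c i j)%N.
Proof. by rewrite /is_label rtildeE /= rmaxE leq_subLR. Qed.

Lemma mem_rel i j l x y : ((x, y) \in rel_of c i j l) =
  [&& fiber_index x == i, fiber_index y == j &
      cosN (angle x - angle y) == cosN (angle_gap i j (l - eps i j))].
Proof.
rewrite inE /= !mem_bajnok_fiber //.
by case: eqP => //= <-; case: eqP => //= <-; rewrite cosine_bajnok.
Qed.

End Config.

(** * Coherence *)

Lemma mem_labels (Omega X : finType) (c : labelling Omega X) i j l :
  (l \in labels c i j) = is_label c i j l.
Proof. by rewrite mem_iota /is_label; have : (eps i j <= 1)%N := leq_b1 _; lia. Qed.

Lemma relationsP (Omega X : finType) (c : labelling Omega X) Q :
  reflect (exists i j l, is_label c i j l /\ Q = rel_of c i j l)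
          (Q \in relations c).
Proof.
rewrite inE; apply: (iffP existsP) => [[i /existsP[j /mapP[l]]]|[i [j [l [il ->]]]]].
  by rewrite mem_labels; exists i, j, l.
by exists i; apply/existsP; exists j; apply/map_f; rewrite mem_labels.
Qed.

Lemma mem_transpose (X : finType) (Q : {set X * X}) x y :
  ((x, y) \in transpose Q) = ((y, x) \in Q).
Proof.
apply/imsetP/idP => [[[u v] uv [-> ->]]|yx] //.
by exists (y, x).
Qed.

Lemma mem_diagonal (X : finType) (F : {set X}) x y :
  ((x, y) \in diagonal F) = (x == y) && (x \in F).
Proof.
apply/imsetP/andP => [[z zF [-> ->]]|[/eqP<- xF]]; first by rewrite eqxx.
by exists x.
Qed.

Section Coherent.
Variables (R : realType) (p N : nat) (r : 'I_p -> R).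
Hypotheses (N_gt1 : (1 < N)%N) (r_gt0 : forall i, 0 < r i) (r_inj : injective r).

Let N_gt0 : (0 < N)%N. Proof. exact: ltnW. Qed.
Local Notation X := (bajnok_points N r).
Local Notation c := (bajnok_configuration N r).
Local Notation cosN := (@cosn R N).

Implicit Types (i j : 'I_p) (x y z : X).

Let mem_relE := mem_rel N_gt1 r_gt0 r_inj.

Lemma cosn_swap x y : cosN (angle x - angle y) = cosN (angle y - angle x).
Proof. by rewrite -cosnN opprB. Qed.

Lemma label_exists x y : exists2 l, is_label c (fiber_index x) (fiber_index y) l &
  (x, y) \in rel_of c (fiber_index x) (fiber_index y) l.
Proof.
have [m mN eqm] := gap_fold N_gt1 x y.
exists (eps (fiber_index x) (fiber_index y) + m)%N.
  by rewrite labelP // leq_addr addKn rtildeE.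
by rewrite mem_relE !eqxx addKn eqm eqxx.
Qed.

Lemma label_unique i j l l' x y : is_label c i j l -> is_label c i j l' ->
  (x, y) \in rel_of c i j l -> (x, y) \in rel_of c i j l' -> l = l'.
Proof.
rewrite !labelP // rtildeE // => /andP[le lN] /andP[le' lN'].
rewrite !mem_relE => /and3P[_ _ /eqP->] /and3P[_ _ /eqP].
by move/(gap_inj N_gt1 lN lN'); lia.
Qed.

Lemma rel_inhabited i j l : exists xy, xy \in rel_of c i j l.
Proof.
have [y fy] := fiber_inhabited N_gt1 r_gt0 r_inj j.
have [x fx eqx] := gap_surj N_gt1 r_gt0 r_inj y i (l - eps i j).
by exists (x, y); rewrite mem_relE fx fy !eqxx eqx fy eqxx.
Qed.

Lemma rel_label i j l i' j' l' x y : is_label c i j l -> is_label c i' j' l' ->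
  (x, y) \in rel_of c i j l -> (x, y) \in rel_of c i' j' l' ->
  [/\ i = i', j = j' & l = l'].
Proof.
move=> il il' xy xy'.
have : (x, y) \in rel_of c i j l := xy; have : (x, y) \in rel_of c i' j' l' := xy'.
rewrite !mem_relE => /and3P[/eqP fx /eqP fy _] /and3P[/eqP fx' /eqP fy' _].
subst i j i' j'; split=> //; exact: label_unique xy xy'.
Qed.

Lemma mem_fiber i x : (x \in fiber c i) = (fiber_index x == i).
Proof. by rewrite inE mem_bajnok_fiber. Qed.

Lemma rel_diag i : rel_of c i i 0 = diagonal (fiber c i).
Proof.
apply/setP => -[x y]; rewrite mem_relE mem_diagonal mem_fiber.
rewrite /angle_gap muln0 xi_ii cosn0 andbC.
apply/andP/andP => [[/andP[fy /eqP xy] fx]|[/eqP<- ->]].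
  split=> //; apply/eqP; apply: angle_inj => //.
  by rewrite (eqP fx) (eqP fy).
by rewrite subrr cosn0 eqxx.
Qed.

Lemma rel0_sub_diagonal i : rel_of c i i 0 \subset diagonal [set: X].
Proof.
rewrite rel_diag; apply/subsetP => -[x y].
by rewrite !mem_diagonal in_setT andbT => /andP[].
Qed.

Lemma rel_transpose i j l : rel_of c j i l = transpose (rel_of c i j l).
Proof.
apply/setP => -[x y]; rewrite mem_transpose !mem_relE cosn_swap /angle_gap xiC epsC.
by rewrite andbCA.
Qed.

Lemma label_sym i j l : is_label c i j l = is_label c j i l.
Proof. by rewrite !labelP // epsC rtildeC. Qed.

(** The left member is obtained from the right one by the motion of the circle
taking a to a' and b to b': the rotation by 2m, or the reflection followed by
it. Both permute the angles 2k + e. *)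
Lemma sum_cosn_isometry (V : nmodType) (g : R -> R -> V) (e a b a' b' m q : int) :
  (a' = a + 2 * m /\ b' = b + 2 * m + q * (2 * N)%:Z) \/
  (a' = - a + 2 * m /\ b' = - b + 2 * m + q * (2 * N)%:Z) ->
  \sum_(k < N) g (cosN (a' - (2 * k%:Z + e))) (cosN (2 * k%:Z + e - b')) =
  \sum_(k < N) g (cosN (a - (2 * k%:Z + e))) (cosN (2 * k%:Z + e - b)).
Proof.
pose F k := g (cosN (a - (2 * k + e))) (cosN (2 * k + e - b)).
have FN k : F (k + N%:Z) = F k.
  rewrite /F -[in RHS](cosn_per R N_gt0 (a - _) (-1)).
  rewrite -[in RHS](cosn_per R N_gt0 (_ - b) 1).
  by congr (g (cosN _) (cosN _)); lia.
case=> -[-> ->].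
  rewrite -(sum_periodic_shift N_gt0 FN (- m)); apply: eq_bigr => k _; rewrite /F.
  rewrite -[cosN (_ - (_ + q * _))](cosn_per R N_gt0 _ q).
  by congr (g (cosN _) (cosN _)); lia.
pose G k := F (k + (m - e)).
have GN k : G (k + N%:Z) = G k by rewrite /G addrAC FN.
rewrite -(sum_periodic_shift N_gt0 FN (m - e)) -(sum_periodic_opp N_gt0 GN).
apply: eq_bigr => k _; rewrite /G /F.
rewrite -[cosN (- a + _ - _)]cosnN -[cosN (_ - (_ + q * _))](cosn_per R N_gt0 _ q).
rewrite -[cosN (_ + q * _)]cosnN.
by congr (g (cosN _) (cosN _)); lia.
Qed.

Lemma intersection_numberE i j l i' j' l' x y :
  intersection_number (rel_of c i j l) (rel_of c i' j' l') x y =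
  ([&& fiber_index x == i, j == i' & fiber_index y == j'] *
   \sum_(k < N)
     ((cosN (angle x - (2 * k%:Z + j.+1%:Z)) ==
         cosN (angle_gap i j (l - eps i j))) &&
      (cosN (2 * k%:Z + j.+1%:Z - angle y) ==
         cosN (angle_gap i' j' (l' - eps i' j')))))%N.
Proof.
pose G a : nat :=
  (cosN (angle x - a) == cosN (angle_gap i j (l - eps i j))) &&
  (cosN (a - angle y) == cosN (angle_gap i' j' (l' - eps i' j'))).
have GN a : G (a + (2 * N)%:Z) = G a.
  rewrite /G -[in RHS](cosn_per R N_gt0 (_ - a) (-1)).
  rewrite -[in RHS](cosn_per R N_gt0 (a - _) 1).
  by congr (nat_of_bool ((cosN _ == _) && (cosN _ == _))); ring.
rewrite -(sum_fiber N_gt1 r_gt0 r_inj j GN) /intersection_number.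
rewrite -sum1_card big_distrr /=.
rewrite big_mkcond [RHS]big_mkcond /=; apply: eq_bigr => z _.
rewrite inE !mem_relE /G; case: (fiber_index z =P j) => [->|_]; last first.
  by rewrite andbF.
rewrite andTb; case: (fiber_index x == i); last by rewrite mul0n.
case: (j == i'); last by rewrite mul0n andbF.
by case: (fiber_index y == j'); rewrite ?mul1n ?mul0n ?andbF //=; case: (_ && _).
Qed.

(** Two pairs of the same relation have gaps equal up to sign modulo 2N, hence
a rotation or a reflection preserving all fibers carries one to the other. *)
Lemma intersection_number_const i j l i' j' l' i0 j0 l0 x y x' y' :
  (x, y) \in rel_of c i0 j0 l0 -> (x', y') \in rel_of c i0 j0 l0 ->
  intersection_number (rel_of c i j l) (rel_of c i' j' l') x y =
  intersection_number (rel_of c i j l) (rel_of c i' j' l') x' y'.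
Proof.
rewrite !mem_relE => /and3P[/eqP fx /eqP fy /eqP cxy].
move=> /and3P[/eqP fx' /eqP fy' /eqP cxy'].
rewrite !intersection_numberE fx fy fx' fy'; congr (_ * _)%N.
have [k eqx] := angle_parity x; have [k' eqx'] := angle_parity x'.
rewrite -cxy in cxy'; have [q] := (cosnP R N_gt0 _ _).1 cxy'.
rewrite fx in eqx; rewrite fx' in eqx'.
move=> eqd; apply/esym.
pose g (u v : R) : nat := (u == cosN (angle_gap i j (l - eps i j))) &&
                    (v == cosN (angle_gap i' j' (l' - eps i' j'))).
case: eqd => eqd.
  by apply: (@sum_cosn_isometry _ g _ _ _ _ _ (k' - k) (- q)); left; lia.
by apply: (@sum_cosn_isometry _ g _ _ _ _ _ (k + k' + i0.+1%:Z) (- q)); right; lia.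
Qed.

Hypothesis p_gt0 : (0 < p)%N.

Lemma bajnok_coherent : coherent_configuration (relations c).
Proof.
have cover_rel x y : exists2 Q, Q \in relations c & (x, y) \in Q.
  have [l il xy] := label_exists x y; eexists; last exact: xy.
  by apply/relationsP; do 3!eexists; split; first exact: il.
split.
- have [x _] := fiber_inhabited N_gt1 r_gt0 r_inj (Ordinal p_gt0).
  by apply/card_gt0P; exists x.
- apply/and3P; split.
  + apply/eqP/setP => -[x y]; rewrite inE; apply/bigcupP.
    by have [Q] := cover_rel x y; exists Q.
  + apply/trivIsetP => Q Q' /relationsP[i [j [l [il ->]]]].
    move=> /relationsP[i' [j' [l' [il' ->]]]] neq.
    apply/pred0Pn => -[[x y] /andP[/= xy xy']].
    by have [ei ej el] := rel_label il il' xy xy'; rewrite ei ej el eqxx in neq.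
  + apply/negP => /relationsP[i [j [l [_ Q0]]]].
    by have [xy] := rel_inhabited i j l; rewrite -Q0 inE.
- move=> _ /relationsP[i [j [l [il ->]]]] /set0Pn[[x y]].
  rewrite inE mem_diagonal => /andP[xy /andP[/eqP eqxy _]]; subst y.
  have il0 : is_label c (fiber_index x) (fiber_index x) 0.
    by rewrite labelP // /eps eqxx.
  have xx : (x, x) \in rel_of c (fiber_index x) (fiber_index x) 0.
    by rewrite rel_diag mem_diagonal mem_fiber !eqxx.
  have [-> -> ->] := rel_label il il0 xy xx.
  exact: rel0_sub_diagonal.
- move=> _ /relationsP[i [j [l [il ->]]]]; rewrite -rel_transpose.
  by apply/relationsP; exists j, i, l; rewrite label_sym.
move=> _ _ Q /relationsP[i [j [l [_ ->]]]] /relationsP[i' [j' [l' [_ ->]]]].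
move=> /relationsP[i0 [j0 [l0 [_ ->]]]] x y x' y'.
exact: intersection_number_const.
Qed.

Lemma bajnok_labelled : labelled_coherent_configuration c.
Proof.
split; first exact: bajnok_coherent.
have label0 i : is_label c i i 0 by rewrite labelP // /eps eqxx.
split=> [|i j l i' j' l' il il' eqr|i j l il|i|i j l il].
- split=> [i j eqf|].
    have [x fx] := fiber_inhabited N_gt1 r_gt0 r_inj i.
    have : x \in fiber c i by rewrite mem_fiber fx.
    by rewrite eqf mem_fiber fx => /eqP.
  apply/setP => F; apply/imsetP/imsetP => [[Q]|[i _ ->]].
    rewrite inE => /andP[/relationsP[i [j [l [il ->]]]] sub] ->.
    have [[x y] xy] := rel_inhabited i j l.
    have := subsetP sub _ xy; rewrite mem_diagonal => /andP[/eqP eqxy _]; subst y.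
    exists i => //; apply/setP => z; rewrite inE mem_fiber.
    have xx : (x, x) \in rel_of c (fiber_index x) (fiber_index x) 0.
      by rewrite rel_diag mem_diagonal mem_fiber !eqxx.
    have [-> -> ->] := rel_label il (label0 _) xy xx.
    by rewrite rel_diag mem_diagonal eqxx mem_fiber.
  exists (rel_of c i i 0).
    rewrite inE; apply/andP; split; first by apply/relationsP; exists i, i, 0%N.
    exact: rel0_sub_diagonal.
  by apply/setP => x; rewrite inE rel_diag mem_diagonal eqxx.
- have [[x y] xy] := rel_inhabited i j l.
  by apply: (rel_label il il' xy); rewrite -eqr.
- apply/subsetP => -[x y]; rewrite mem_relE in_setX !mem_fiber /=.
  by case/and3P=> -> ->.
- exact: rel_diag.
by rewrite -label_sym rel_transpose.
Qed.

Lemma bajnok_symmetric : symmetric_fibers c.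
Proof. by move=> i l _; rewrite -rel_transpose. Qed.

End Coherent.

(** * The basis of zonal kernels *)

Section Basis.
Local Open Scope complex_scope.
Variables (R : realType) (p N : nat) (r : 'I_p -> R).
Hypotheses (N_gt1 : (1 < N)%N) (r_gt0 : forall i, 0 < r i) (r_inj : injective r).

Let N_gt0 : (0 < N)%N. Proof. exact: ltnW. Qed.
Local Notation X := (bajnok_points N r : finType).
Local Notation c := (bajnok_configuration N r).
Local Notation cosN := (@cosn R N).

Implicit Types (i j : 'I_p) (x y z : X) (g : int -> R[i]).

(** When g is periodic modulo 2N, this is a matrix of the block (i, j) that is
invariant under rotation. *)
Definition circulant i j (g : int -> R[i]) : 'M[R[i]]_#|X| :=
  \matrix_(a, b) if (fiber_index (enum_val a) == i) && (fiber_index (enum_val b) == j)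
                 then g (angle (enum_val a) - angle (enum_val b)) else 0.

Lemma eq_circulant i j (g g' : int -> R[i]) :
  (forall x y : X, fiber_index x = i -> fiber_index y = j ->
     g (angle x - angle y) = g' (angle x - angle y)) ->
  circulant i j g = circulant i j g'.
Proof.
move=> gg'; apply/matrixP => a b; rewrite !mxE.
by case: ifP => // /andP[/eqP fa /eqP fb]; apply: gg'.
Qed.

Lemma circulant_tr i j g : (forall a, g (- a) = g a) ->
  (circulant i j g)^T = circulant j i g.
Proof.
by move=> gN; apply/matrixP => a b; rewrite !mxE andbC -gN opprB.
Qed.

Lemma circulantD i j (g g' : int -> R[i]) :
  circulant i j g + circulant i j g' = circulant i j (fun a => g a + g' a).
Proof. by apply/matrixP => a b; rewrite !mxE; case: ifP => // _; rewrite addr0. Qed.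

Lemma circulantZ i j k g : k *: circulant i j g = circulant i j (fun a => k * g a).
Proof. by apply/matrixP => a b; rewrite !mxE; case: ifP => // _; rewrite mulr0. Qed.

Lemma circulantM0 i j i' j' (g g' : int -> R[i]) : j != i' ->
  circulant i j g *m circulant i' j' g' = 0.
Proof.
move=> ij; apply/matrixP => a b; rewrite !mxE big1 // => k _; rewrite !mxE.
case: (boolP (fiber_index (enum_val k) == j)) => [/eqP->|_]; last first.
  by rewrite andbF mul0r.
by rewrite (negPf ij) mulr0.
Qed.

Lemma circulantM i j j' (g g' g2 : int -> R[i]) :
  (forall x y : X, fiber_index x = i -> fiber_index y = j' ->
     \sum_(z : X | fiber_index z == j) g (angle x - angle z) * g' (angle z - angle y) =
     g2 (angle x - angle y)) ->
  circulant i j g *m circulant j j' g' = circulant i j' g2.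
Proof.
move=> conv; apply/matrixP => a b; rewrite !mxE.
case: ifP => [/andP[/eqP fa /eqP fb]|fab].
  rewrite -conv // (reindex (fun k : 'I_#|X| => enum_val k)) /=; last first.
    exact/onW_bij/enum_val_bij.
  rewrite [RHS]big_mkcond; apply: eq_bigr => k _; rewrite !mxE fa fb !eqxx /=.
  by rewrite andbT; case: ifP => // _; rewrite mul0r.
rewrite big1 // => k _; rewrite !mxE.
move/nandP: (negbT fab) => [/negPf->|/negPf->]; first by rewrite mul0r.
by rewrite andbF mulr0.
Qed.

Lemma adjE i j l : adj R c i j l =
  circulant i j (fun a => (cosN a == cosN (angle_gap i j (l - eps i j)))%:R).
Proof.
apply/matrixP => a b; rewrite !mxE (mem_rel N_gt1) // andbA.
by case: ifP.
Qed.

Lemma sum_fiber_conv (g g' : int -> R[i]) x y j :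
  (forall a, g (a + (2 * N)%:Z) = g a) -> (forall a, g' (a + (2 * N)%:Z) = g' a) ->
  \sum_(z : X | fiber_index z == j) g (angle x - angle z) * g' (angle z - angle y) =
  \sum_(k < N) g (angle x - (2 * k%:Z + j.+1%:Z)) *
               g' (2 * k%:Z + j.+1%:Z - angle y).
Proof.
move=> gN g'N.
rewrite (sum_fiber N_gt1 r_gt0 r_inj j
           (G := fun a => g (angle x - a) * g' (a - angle y))) // => a.
congr (_ * _); last by rewrite addrAC g'N.
by rewrite -gN; congr g; ring.
Qed.

Lemma card_fiber i : #|fiber c i| = N.
Proof.
rewrite -sum1_card; under eq_bigl do rewrite mem_fiber //.
by rewrite (@sum_fiber _ _ _ _ _ _ _ _ (fun=> 1%N)) // sum1_card card_ord.
Qed.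

(** The inverse of the mean of cos(h x)^2 over the multiples x of 2 pi / N. *)
Definition weight (h : nat) : R := if (h == 0%N) || (2 * h == N)%N then 1 else 2.

Definition zonal (h : nat) (a : int) : R := weight h / N%:R * cosN (h%:Z * a).

Lemma zonal_per h a : zonal h (a + (2 * N)%:Z) = zonal h a.
Proof. by rewrite /zonal mulrDr (cosn_per R N_gt0). Qed.

(** The product of two cosines is a half sum of a cosine of argument linear in
(h' - h) k and one of argument linear in (h' + h) k. The first sum survives
only when h = h', the second one only when h = h' is 0 or N/2; for h = N/2 it
equals the first one when b and e have the same parity, and is its opposite
otherwise. *)
Lemma zonal_conv h h' (a b e : int) :
  (2 * h <= N)%N -> (2 * h' <= N)%N ->
  ((2 * h' = N)%N -> exists m : int, b = 2 * m + e) ->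
  \sum_(k < N) zonal h (a - (2 * k%:Z + e)) *
               zonal h' (2 * k%:Z + e - b) =
  if h == h' then zonal h (a - b) else 0.
Proof.
move=> hN h'N par.
have Nr : N%:R != 0 :> R by rewrite pnatr_eq0 -lt0n.
pose d1 : int := h%:Z * a - h'%:Z * b + (h'%:Z - h%:Z) * e.
pose d2 : int := h%:Z * a + h'%:Z * b - (h'%:Z + h%:Z) * e.
transitivity (weight h / N%:R * (weight h' / N%:R) / 2 *
  (\sum_(k < N) cosN (2 * (h'%:Z - h%:Z) * k%:Z + d1) +
   \sum_(k < N) cosN (2 * - (h'%:Z + h%:Z) * k%:Z + d2))).
  rewrite -big_split mulr_sumr; apply: eq_bigr => k _ /=.
  set u := h%:Z * (a - (2 * k%:Z + e)); set v := h'%:Z * (2 * k%:Z + e - b).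
  have -> : 2 * (h'%:Z - h%:Z) * k%:Z + d1 = u + v by rewrite /d1 /u /v; ring.
  have -> : 2 * - (h'%:Z + h%:Z) * k%:Z + d2 = u - v by rewrite /d2 /u /v; ring.
  have -> : cosN (u + v) + cosN (u - v) = 2 * (cosN u * cosN v).
    by rewrite cosnM //; field.
  by rewrite /zonal -/u -/v; field.
have [eqh|neqh] := eqVneq h h'; last first.
  by rewrite !sum_cosn // ?addr0 ?mulr0 //;
    apply/negP => /dvdzP[q]; case: (intP q) => [|m|m]; nia.
subst h'.
have -> : \sum_(k < N) cosN (2 * (h%:Z - h%:Z) * k%:Z + d1) =
    N%:R * cosN (h%:Z * (a - b)).
  rewrite (eq_bigr (fun=> cosN (h%:Z * (a - b)))) => [|k _]; last first.
    by congr cosn; rewrite /d1; ring.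
  by rewrite sumr_const card_ord mulr_natl.
rewrite /zonal /weight.
case: ifP => [extreme|generic].
  rewrite (eq_bigr (fun=> cosN (h%:Z * (a - b)))) => [|k _].
    by rewrite sumr_const card_ord -mulr_natl; field.
  case/orP: extreme => /eqP h0; first by rewrite h0 /d2 h0 !mul0r; congr cosn; ring.
  have [m eqb] := par h0.
  rewrite -[RHS](cosn_per R N_gt0 _ (m - k%:Z)); congr cosn.
  have -> : (2 * N)%:Z = 2 * (2 * h%:Z) by lia.
  by rewrite /d2 eqb; ring.
rewrite sum_cosn // ?addr0; first by field.
apply/negP => /dvdzP[q]; case: (intP q) => [|m|m]; move: generic; nia.
Qed.

Definition zonal_basis i j h : 'M[R[i]]_#|X| :=
  if (h <= rtilde c i j)%N then circulant i j (fun a => (zonal h a)%:C) else 0.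

Lemma rtilde_bound i j h : (h <= rtilde c i j)%N -> (2 * h <= N)%N.
Proof. by rewrite rtildeE //; have := xi_le1 i j; lia. Qed.

Lemma rtilde_diag i j h : (h <= rtilde c i j)%N -> (h <= rtilde c j j)%N.
Proof. by rewrite !rtildeE // xi_ii; have := xi_le1 i j; lia. Qed.

(** The kernel of degree N/2 vanishes at odd gaps, and blocks of odd gaps have
one relation less. *)
Lemma rtilde_extreme i j h : (h <= rtilde c i j)%N -> (2 * h = N)%N ->
  odd i.+1 = odd j.+1.
Proof. by rewrite rtildeE // /xi; case: eqP => //= _; lia. Qed.

Lemma zonal_basisM i j h i' j' h' :
  (h <= rtilde c i j)%N -> (h' <= rtilde c i' j')%N ->
  zonal_basis i j h *m zonal_basis i' j' h' =
    if (j == i') && (h == h') then zonal_basis i j' h else 0.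
Proof.
move=> hN h'N; rewrite {1 2}/zonal_basis hN h'N.
have [eqj|neqj] := eqVneq j i'; last by rewrite circulantM0.
subst i'; rewrite andTb.
rewrite (@circulantM _ _ _ _ _ (fun a => if h == h' then (zonal h a)%:C else 0)).
  case: eqP => [eqh|_]; last by apply/matrixP => a b; rewrite !mxE if_same.
  subst h'; rewrite /zonal_basis; case: leqP => // hbig.
  move: hbig; rewrite rtildeE // => hbig.
  (* Only h = N/2 could be a degree of (i, j) and (j, j') without being one of
     (i, j'); then i and j' have different parities, but both agree with j. *)
  exfalso; move: hN h'N hbig; rewrite !rtildeE // /xi.
  case: (odd i.+1); case: (odd j.+1); case: (odd j'.+1) => /=; lia.
move=> x y fx fy.
rewrite (@sum_fiber_conv (fun a => (zonal h a)%:C)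
                         (fun a => (zonal h' a)%:C)); last 2 first.
- by move=> a; rewrite zonal_per.
- by move=> a; rewrite zonal_per.
under eq_bigr do rewrite -rmorphM.
rewrite -rmorph_sum (zonal_conv _ (rtilde_bound hN) (rtilde_bound h'N)).
  by case: eqP.
move=> /(rtilde_extreme h'N) par; have [k ->] := angle_parity y; rewrite fy.
exists ((2 * k + j'.+1%:Z - j.+1%:Z) %/ 2)%Z; lia.
Qed.

Lemma zonal_basis_neq0 i h : (h <= rtilde c i i)%N -> zonal_basis i i h != 0.
Proof.
move=> hN; rewrite /zonal_basis hN.
have [x fx] := fiber_inhabited N_gt1 r_gt0 r_inj i.
apply/eqP => /matrixP/(_ (enum_rank x) (enum_rank x)).
rewrite !mxE !enum_rankK fx !eqxx subrr /zonal mulr0 cosn0 mulr1 => /eqP.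
rewrite fmorph_eq0; apply/negP; rewrite mulf_neq0 ?invr_eq0 ?pnatr_eq0 -?lt0n //.
by rewrite /weight; case: ifP; rewrite ?oner_eq0 ?pnatr_eq0.
Qed.

(** Freeness follows from the product rule, which makes E_h^(j,i) isolate the
coefficient of E_h^(i,j). There are as many kernels as relations, so
expressing the kernels by adjacency matrices suffices. *)
Lemma zonal_basis_span i j :
  basis_of <<[seq adj R c i j l | l <- labels c i j]>>%VS
           [seq zonal_basis i j h | h <- iota 0 (rtilde c i j).+1].
Proof.
rewrite basisEfree; apply/and3P; split.
- pose s := [tuple of map (zonal_basis i j) (iota_tuple (rtilde c i j).+1 0)].
  apply/(@freeP _ _ _ s) => k sum0 h.
  have hN : (h <= rtilde c i j)%N by rewrite -ltnS.
  have hNi : (h <= rtilde c j i)%N by rewrite (rtildeC N_gt1 r_gt0 r_inj j i).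
  have nthE (m : 'I_(rtilde c i j).+1) : s`_m = zonal_basis i j m.
    by rewrite (nth_map 0%N) ?size_iota // nth_iota.
  have := congr1 (mulmx^~ (zonal_basis j i h)) sum0.
  rewrite mulmx_suml mul0mx (bigD1 h) //= big1 => [|m neq].
    rewrite addr0 nthE -scalemxAl zonal_basisM // !eqxx => /eqP.
    rewrite scaler_eq0 => /orP[/eqP//|/negPn/negP[]].
    by rewrite zonal_basis_neq0 // (rtilde_diag hNi).
  rewrite nthE -scalemxAl zonal_basisM -1?ltnS // eqxx /=.
  by rewrite (negPf (_ : (m : nat) != h)) ?scaler0.
- apply/span_subvP => B /mapP[h]; rewrite mem_iota => hN ->.
  have -> : zonal_basis i j h = \sum_(l <- labels c i j)
    (zonal h (angle_gap i j (l - eps i j)))%:C *: adj R c i j l.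
    rewrite add0n ltnS /= in hN; rewrite /zonal_basis hN.
    apply/matrixP => a b; rewrite summxE !mxE.
    have term l : (zonal h (angle_gap i j (l - eps i j)))%:C *: adj R c i j l =
        circulant i j (fun a => (zonal h (angle_gap i j (l - eps i j)))%:C *
                         (cosN a == cosN (angle_gap i j (l - eps i j)))%:R).
      by rewrite adjE circulantZ.
    under eq_bigr => l _ do rewrite term mxE.
    case: ifP => [/andP[/eqP fa /eqP fb]|_]; last by rewrite big1.
    have [l] := label_exists N_gt1 r_gt0 r_inj (enum_val a) (enum_val b).
    rewrite fa fb => il; have := mem_labels c i j l; rewrite il => il'.
    rewrite mem_rel // => /and3P[_ _ /eqP eql].
    rewrite (bigD1_seq l) ?iota_uniq //= big1_seq => [|m /andP[neq im]].
      rewrite addr0 -eql eqxx mulr1; congr (_ * _)%:C.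
      exact: cosn_scale.
    case: eqP => [eqm|_]; last by rewrite mulr0.
    case/eqP: neq; apply/esym; rewrite mem_labels in im.
    apply: (label_unique N_gt1 r_gt0 r_inj (x := enum_val a) (y := enum_val b) il im).
      by rewrite mem_rel // fa fb !eqxx eql eqxx.
    by rewrite mem_rel // fa fb !eqxx eqm eqxx.
  rewrite big_seq; apply: memv_suml => l il.
  by apply/memvZ/memv_span/map_f.
rewrite size_map size_iota (leq_trans (dim_span _)) // size_map size_iota.
by rewrite /rtilde; have : (eps i j <= 1)%N := leq_b1 _; lia.
Qed.

Lemma bajnok_basis : idempotent_basis (R := R) c zonal_basis.
Proof.
split.
- by move=> i j h hN; rewrite /zonal_basis leqNgt hN.
- move=> i j; rewrite /zonal_basis leq0n !card_fiber.
  rewrite natrM -expr2 sqrtr_sqr normr_nat.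
  apply/matrixP => a b; rewrite !mxE in_setX !mem_fiber //.
  rewrite /zonal /weight eqxx mul0r cosn0 mulr1 mul1r.
  by case: ifP; rewrite ?mulr1 ?mulr0.
- exact: zonal_basis_span.
- move=> i j h hN; have hN' : (h <= rtilde c j i)%N by rewrite rtildeC.
  rewrite /zonal_basis hN hN'.
  by apply: circulant_tr => a; rewrite /zonal mulrN cosnN.
exact: zonal_basisM.
Qed.

End Basis.

(** * Eigenvalues and the three-term recurrence *)

Section ThreeTerm.
Variables (K : fieldType) (q : {poly K}).

(** For q = X / 2 these are the Chebyshev polynomials of the first kind in the
variable X / 2. *)
Fixpoint three_term (m : nat) : {poly K} :=
  if m is m1.+1 then
    if m1 is m2.+1 then three_term m1 * 'X - three_term m2 else q
  else 1.

Lemma size_three_term m : size q = 2 -> size (three_term m) = m.+1.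
Proof.
move=> size_q.
suff [] : size (three_term m) = m.+1 /\ size (three_term m.+1) = m.+2 by [].
elim: m => [|m [IH0 IH1]]; first by rewrite size_poly1.
split=> //; rewrite [three_term _]/= -/(three_term m.+1) size_polyDl ?size_polyN.
  by rewrite size_mulX ?IH1 // -size_poly_eq0 IH1.
by rewrite size_mulX ?IH1 ?IH0 // -size_poly_eq0 IH1.
Qed.

Lemma three_term_eval (g : K) (b : nat -> K) (M : nat) :
  ((0 < M)%N -> b 1%N = q.[g] * b 0%N) ->
  (forall m, (m.+2 <= M)%N -> b m.+2 = g * b m.+1 - b m) ->
  forall m, (m <= M)%N -> b m = (three_term m).[g] * b 0%N.
Proof.
move=> b1 b2 m; suff: ((m <= M)%N -> b m = (three_term m).[g] * b 0%N) /\
  ((m.+1 <= M)%N -> b m.+1 = (three_term m.+1).[g] * b 0%N) by case.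
elim: m => [|m [IH0 IH1]]; first by split=> // _; rewrite hornerC mul1r.
split=> // mM; rewrite b2 // IH1 ?(ltnW mM) // IH0 ?(ltnW (ltnW mM)) //.
rewrite [three_term m.+2]/= -/(three_term m.+1) hornerD hornerN hornerMX; ring.
Qed.

End ThreeTerm.

Section Eigenvalues.
Local Open Scope complex_scope.
Variables (R : rcfType) (Omega X : finType) (c : labelling Omega X).
Variables (E : Omega -> Omega -> nat -> 'M[R[i]]_#|X|).
Variables (P : Omega -> Omega -> nat -> nat -> R[i]).
Hypotheses (basisE : idempotent_basis c E) (eigP : eigenvalues c E P).

(** Multiplying by E_h^(j,j) selects the component of degree h, and turns
identities between matrices into identities between eigenvalues. *)
Lemma adj_mulE i j l h : is_label c i j l -> (h <= rtilde c i j)%N ->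
  (h <= rtilde c j j)%N -> adj R c i j l *m E j j h = P i j l h *: E i j h.
Proof.
case: basisE => _ _ _ _ mulE il hN hNj; rewrite eigP // mulmx_suml.
rewrite (bigD1_seq h) ?iota_uniq ?mem_index_iota //= -scalemxAl mulE // !eqxx /=.
rewrite big1_seq ?addr0 // => m /andP[neq].
rewrite mem_index_iota => mN; rewrite -scalemxAl mulE // eqxx /=.
by rewrite (negPf neq) scaler0.
Qed.

Lemma basis_neq0 i j h : (h <= rtilde c i j)%N -> E i j h != 0.
Proof.
case: basisE => _ _ basis _ _ hN.
apply: (free_not0 (basis_free (basis i j))); apply: map_f.
by rewrite mem_iota.
Qed.

(** Otherwise E_h^(j,j) would annihilate the whole block (i, j) on the right,
and in particular E_h^(i,j) = E_h^(i,j) E_h^(j,j) would vanish. *)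
Lemma eigenvalues_neq0 i j h : (h <= rtilde c i j)%N -> (h <= rtilde c j j)%N ->
  exists2 l, is_label c i j l & P i j l h != 0.
Proof.
move=> hN hNj; case: (altP (@hasP _ (fun l => P i j l h != 0) (labels c i j))).
  by case=> l; rewrite mem_labels; exists l.
move/hasPn => P0; case/eqP: (basis_neq0 hN).
case: basisE => _ _ basis _ mulE.
have := mulE i j h j j h hN hNj; rewrite !eqxx /= => <-.
suff /subvP/(_ (E i j h)) : (<<[seq adj R c i j l | l <- labels c i j]>> <=
    lker (linfun (mulmxr (E j j h))))%VS.
  rewrite memv_ker lfunE /= => /(_ _)/eqP; apply.
  by apply: (basis_mem (basis i j)); apply: map_f; rewrite mem_iota.
apply/span_subvP => B /mapP[l il ->]; rewrite memv_ker lfunE /=.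
have /negPn/eqP Pl := P0 l il; rewrite mem_labels in il.
by rewrite adj_mulE // Pl scale0r.
Qed.

End Eigenvalues.

(** * The P-polynomial property *)

Section Polynomial.
Local Open Scope complex_scope.
Variables (R : realType) (p N : nat) (r : 'I_p -> R).
Hypotheses (N_gt1 : (1 < N)%N) (r_gt0 : forall i, 0 < r i) (r_inj : injective r).

Let N_gt0 : (0 < N)%N. Proof. exact: ltnW. Qed.
Local Notation X := (bajnok_points N r : finType).
Local Notation c := (bajnok_configuration N r).
Local Notation cosN := (@cosn R N).

Local Notation circ := (@circulant R p N r).

Implicit Types (i j : 'I_p) (x y z : X) (u : int).

Definition turn_indicator (a : int) : R[i] := ((2 * N)%:Z %| a)%Z%:R.

Lemma turn_indicator_per a : turn_indicator (a + (2 * N)%:Z) = turn_indicator a.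
Proof. by rewrite /turn_indicator rpredDr // dvdzz. Qed.

(** As a function of the gap, this is the kernel of T^u + T^(-u), where T is
the rotation by pi/N. *)
Definition rot_pair u (a : int) : R[i] :=
  turn_indicator (a - u) + turn_indicator (a + u).

(** For N dividing n the rotations T^n and T^(-n) coincide. *)
Definition multiplicity (n : nat) : R[i] := if (N %| n)%N then 2 else 1.

Lemma multiplicity_neq0 n : multiplicity n != 0.
Proof. by rewrite /multiplicity; case: ifP; rewrite ?oner_eq0 ?pnatr_eq0. Qed.

Lemma rot_pair_per u a : rot_pair u (a + (2 * N)%:Z) = rot_pair u a.
Proof.
by rewrite /rot_pair (addrAC a _ (- u)) (addrAC a _ u) !turn_indicator_per.
Qed.

Lemma rot_pairE (n : nat) (a : int) :
  rot_pair n a = multiplicity n * (cosN a == cosN n%:Z)%:R.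
Proof.
have -> : (cosN a == cosN n%:Z) =
    ((2 * N)%:Z %| a - n%:Z)%Z || ((2 * N)%:Z %| a + n%:Z)%Z.
  apply/eqP/orP => [/(cosnP R N_gt0)[q [|] ->]|[] /dvdzP[q eqq]].
  - by left; apply/dvdzP; exists q; ring.
  - by right; apply/dvdzP; exists q; ring.
  - by apply/(cosnP R N_gt0); exists q; left; lia.
  - by apply/(cosnP R N_gt0); exists q; right; lia.
rewrite /rot_pair /turn_indicator /multiplicity.
have dvdE : (N %| n)%N = ((2 * N)%:Z %| 2 * n%:Z)%Z.
  by rewrite PoszM dvdz_mul2l.
have swap : ((2 * N)%:Z %| 2 * n%:Z)%Z ->
    ((2 * N)%:Z %| a - n%:Z)%Z = ((2 * N)%:Z %| a + n%:Z)%Z.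
  move=> dvd; apply/idP/idP => dvda.
    have -> : a + n%:Z = (a - n%:Z) + 2 * n%:Z by ring.
    exact: rpredD.
  have -> : a - n%:Z = (a + n%:Z) - 2 * n%:Z by ring.
  exact: rpredB.
rewrite dvdE; case: ifP => dvd.
  by rewrite (swap dvd) orbb -mulr2n mulr_natl.
rewrite mul1r; case: (boolP (_ %| a - _)%Z) => d1; last by rewrite add0r.
case: (boolP (_ %| a + _)%Z) => d2; last by rewrite addr0.
case/negP: dvd; rewrite (_ : 2 * n%:Z = (a + n%:Z) - (a - n%:Z)); last by ring.
exact: rpredB.
Qed.

Lemma rot_pair_adj i j m :
  circ i j (rot_pair (angle_gap i j m)) =
  multiplicity (2 * m + xi i j) *: adj R c i j (eps i j + m).
Proof.
rewrite adjE // circulantZ addKn; apply: eq_circulant => x y _ _.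
exact: rot_pairE.
Qed.

Lemma rot_pairN i j u : circ i j (rot_pair (- u)) = circ i j (rot_pair u).
Proof. by apply: eq_circulant => x y _ _; rewrite /rot_pair opprK addrC. Qed.

(** Exactly one point of the fiber lies at the even angular distance 2s from
y. *)
Lemma sum_fiber_indicator (G : int -> R[i]) y (s : int) :
  (forall a, G (a + (2 * N)%:Z) = G a) ->
  \sum_(z : X | fiber_index z == fiber_index y)
     G (angle z) * turn_indicator (angle z - angle y - 2 * s) =
  G (angle y + 2 * s).
Proof.
move=> GN; have [k eqy] := angle_parity y.
have [z fz [q eqz]] := angle_surj N_gt1 r_gt0 r_inj (fiber_index y) (k + s).
have eqzy : angle z = angle y + 2 * s + q * (2 * N)%:Z by rewrite eqz eqy; ring.
rewrite (bigD1 z) /=; last by rewrite fz.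
rewrite big1 => [|w /andP[/eqP fw neq]].
  rewrite addr0 eqzy (periodicM GN) /turn_indicator.
  have -> : angle y + 2 * s + q * (2 * N)%:Z - angle y - 2 * s = q * (2 * N)%:Z.
    by ring.
  by rewrite dvdz_mull // mulr1.
rewrite /turn_indicator.
case: (boolP (_ %| _)%Z) => [/dvdzP[q' eqw]|_]; last by rewrite mulr0.
case/eqP: neq; apply: angle_inj; rewrite ?fw //.
rewrite -(cosn0 R N); apply/(cosnP R N_gt0); exists (q' - q); left.
by rewrite eqzy; lia.
Qed.

Lemma rot_pair_shift u d :
  rot_pair u (d - 2) + rot_pair u (d + 2) = rot_pair (u + 2) d + rot_pair (u - 2) d.
Proof.
rewrite /rot_pair addrACA [RHS]addrACA [X in _ = _ + X]addrC.
by congr (turn_indicator _ + turn_indicator _ +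
          (turn_indicator _ + turn_indicator _)); ring.
Qed.

(** This is (T^u + T^(-u)) (T^2 + T^(-2)), expanded. *)
Lemma rot_pair_mul i j u :
  circ i j (rot_pair u) *m circ j j (rot_pair 2) =
  circ i j (rot_pair (u + 2)) + circ i j (rot_pair (u - 2)).
Proof.
rewrite circulantD; apply: circulantM => x y fx fy; rewrite -fy.
have uN a : rot_pair u (angle x - (a + (2 * N)%:Z)) = rot_pair u (angle x - a).
  by rewrite -rot_pair_per; congr (rot_pair u _); ring.
under eq_bigr do rewrite {2}/rot_pair mulrDr.
rewrite big_split /=.
have := sum_fiber_indicator y 1 uN; rewrite mulr1 => ->.
have := sum_fiber_indicator y (-1) uN; rewrite mulrN1 opprK => ->.
by rewrite -rot_pair_shift opprD opprB [2 - _]addrC /rot_pair !addrA.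
Qed.

(** The relations are already numbered in a P-polynomial order. With T the
rotation by pi/N, b m h below is the eigenvalue of degree h of T^u + T^(-u) on
the block (i, j) for the gap u = 2m + xi, and g h that of T^2 + T^(-2) on the
block (j, j). *)
Lemma bajnok_P_polynomial_block (E : 'I_p -> 'I_p -> nat -> 'M[R[i]]_#|X|)
    (P : 'I_p -> 'I_p -> nat -> nat -> R[i]) i j :
  idempotent_basis c E -> eigenvalues c E P -> P_polynomial_block c P i j.
Proof.
move=> basisE eigP.
pose b m h := multiplicity (2 * m + xi i j) * P i j (eps i j + m)%N h.
pose g h := multiplicity 2 * P j j 1%N h.
have isl m : (m <= rtilde c i j)%N -> is_label c i j (eps i j + m).
  by move=> mN; rewrite labelP // leq_addr addKn.
have isl1 : is_label c j j 1.
  by rewrite labelP // /eps eqxx subn0 rtildeE // xi_ii; lia.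
have hNj h : (h <= rtilde c i j)%N -> (h <= rtilde c j j)%N by apply: rtilde_diag.
have bE m h : (m <= rtilde c i j)%N -> (h <= rtilde c i j)%N ->
    circ i j (rot_pair (angle_gap i j m)) *m E j j h = b m h *: E i j h.
  move=> mN hN; rewrite rot_pair_adj -scalemxAl (adj_mulE basisE eigP) ?isl ?hNj //.
  by rewrite scalerA.
have gE h : (h <= rtilde c i j)%N ->
    circ j j (rot_pair 2) *m E j j h = g h *: E j j h.
  move=> hN; have := rot_pair_adj j j 1; rewrite /angle_gap xi_ii /eps eqxx => ->.
  by rewrite -scalemxAl (adj_mulE basisE eigP) ?hNj // scalerA.
have rec u h : (h <= rtilde c i j)%N -> forall e,
    circ i j (rot_pair u) *m E j j h = e *: E i j h ->
    (circ i j (rot_pair (u + 2)) + circ i j (rot_pair (u - 2))) *m E j j h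
      = (g h * e) *: E i j h.
  move=> hN e eqe; rewrite -rot_pair_mul -mulmxA gE // -scalemxAr eqe.
  by rewrite scalerA.
have scalE h (e e' : R[i]) : (h <= rtilde c i j)%N ->
    e *: E i j h = e' *: E i j h -> e = e'.
  move=> hN /eqP; rewrite -subr_eq0 -scalerBl scaler_eq0 subr_eq0.
  by rewrite (negPf (basis_neq0 basisE hN)) orbF => /eqP.
(* In B_(xi-2) the index is -2 for xi = 0 and -1 for xi = 1; this gives
   2 b_1 = g b_0 in the first case and b_1 + b_0 = g b_0 in the second one. *)
pose s : R[i] := (2 - xi i j)%:R.
pose q : {poly R[i]} := s^-1 *: ('X - (xi i j)%:R%:P).
have qE a : q.[a] = s^-1 * (a - (xi i j)%:R) by rewrite hornerZ hornerXsubC.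
have s0 : s != 0 by rewrite pnatr_eq0; have := xi_le1 i j; lia.
have b1 h : (h <= rtilde c i j)%N -> (0 < rtilde c i j)%N ->
    b 1%N h = q.[g h] * b 0%N h.
  move=> hN rt; have := rec _ _ hN _ (bE 0%N h (leq0n _) hN).
  have -> : angle_gap i j 0 + 2 = angle_gap i j 1 by rewrite /angle_gap; lia.
  rewrite mulmxDl bE //.
  have := xi_le1 i j; rewrite leq_eqVlt ltnS leqn0 => /orP[] /eqP xiE.
    have -> : angle_gap i j 0 - 2 = - angle_gap i j 0 by rewrite /angle_gap xiE.
    rewrite rot_pairN bE //.
    rewrite -scalerDl => /(scalE _ _ _ hN) eqb.
    by rewrite qE /s xiE subn1 invr1 mul1r mulrBl -eqb mul1r addrK.
  have -> : angle_gap i j 0 - 2 = - angle_gap i j 1 by rewrite /angle_gap xiE.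
  rewrite rot_pairN bE //.
  rewrite -scalerDl => /(scalE _ _ _ hN) eqb.
  by rewrite qE /s xiE subn0 subr0 -mulrA -eqb; field.
have b2 h m : (h <= rtilde c i j)%N -> (m.+2 <= rtilde c i j)%N ->
    b m.+2 h = g h * b m.+1 h - b m h.
  move=> hN mN; have := rec _ _ hN _ (bE m.+1 h (ltnW mN) hN).
  have -> : angle_gap i j m.+1 + 2 = angle_gap i j m.+2 by rewrite /angle_gap; lia.
  have -> : angle_gap i j m.+1 - 2 = angle_gap i j m by rewrite /angle_gap; lia.
  rewrite mulmxDl !bE ?(ltnW (ltnW mN)) // -scalerDl => /(scalE _ _ _ hN) <-.
  by rewrite addrK.
have bq h m : (h <= rtilde c i j)%N -> (m <= rtilde c i j)%N ->
    b m h = (three_term q m).[g h] * b 0%N h.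
  move=> hN; apply: (three_term_eval (b := b^~ h)); first exact: b1.
  by move=> k; apply: b2.
have b0_neq0 h : (h <= rtilde c i j)%N -> b 0%N h != 0.
  move=> hN; apply/eqP => b0.
  have [l] := eigenvalues_neq0 basisE eigP hN (hNj _ hN).
  rewrite labelP // => /andP[le lN] /eqP[].
  have := bq h (l - eps i j)%N hN lN; rewrite b0 mulr0 /b subnKC // => /eqP.
  by rewrite mulf_eq0 (negPf (multiplicity_neq0 _)) => /eqP.
pose k m : R[i] := multiplicity (2 * m + xi i j).
have PE m h : P i j (eps i j + m)%N h = b m h / k m.
  by rewrite /b mulrAC divff ?mul1r // multiplicity_neq0.
have k0 m : k m != 0 := multiplicity_neq0 _.
exists id; split=> [|//|h hN|].
- by rewrite map_id.
- by rewrite -[eps i j]addn0 PE mulf_neq0 ?b0_neq0 ?invr_eq0.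
(* The inverse of g |-> (k 0 / k 1) q(g), which is the normalized eigenvalue of
   the first relation. *)
pose aff : {poly R[i]} := (s * k 1%N / k 0%N) *: 'X + (xi i j)%:R%:P.
exists (fun l => (k 0%N / k (l - eps i j)%N) *: (three_term q (l - eps i j) \Po aff)).
move=> l; rewrite labelP // => /andP[le lN]; split.
  rewrite size_scale ?mulf_neq0 ?invr_eq0 //.
  rewrite size_comp_poly2 ?size_three_term //.
    by rewrite /q size_scale ?invr_eq0 // size_XsubC.
  rewrite /aff size_polyDl size_scale ?size_polyX ?mulf_neq0 ?invr_eq0 //.
  by rewrite (leq_ltn_trans (size_polyC_leq1 _)).
move=> h hN; rewrite -{1}(subnKC le); move: (l - eps i j)%N lN => m mN.
have PmE n : (n <= rtilde c i j)%N ->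
    P i j (eps i j + n)%N h / P i j (eps i j) h =
    k 0%N / k n * (three_term q n).[g h].
  move=> nN; have := PE 0%N h; rewrite addn0 => ->; rewrite PE bq //.
  by field; rewrite !k0 b0_neq0.
rewrite PmE // hornerZ horner_comp; congr (_ * _).
(* In degree 0 both polynomials are constant, and the block need not have a
   relation of label eps + 1. *)
case: m mN => [|m] mN; first by rewrite !hornerC.
congr (_.[_]); rewrite -addn1 PmE; last exact: leq_trans mN.
rewrite [three_term q 1]/= qE /aff hornerD hornerZ hornerX hornerC.
by field; rewrite !k0 s0.
Qed.

End Polynomial.

Theorem theorem5p4 (R : realType) (t p : nat) (r : 'I_p -> R)
    (ht : (0 < t)%N) (hp : (1 <= p <= (t + 5) %/ 4)%N)
    (hr0 : forall i : 'I_p, 0 < r i)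
    (hr : forall i j : 'I_p, (i < j)%N -> r i < r j) :
  P_polynomial R (bajnok_configuration (t + 3 - 2 * p) r).
Proof.
have N_gt1 : (1 < t + 3 - 2 * p)%N.
  by case/andP: hp => p1; rewrite leq_divRL //; lia.
have r_inj : injective r.
  move=> i j eqr; apply: ord_inj.
  by case: (ltngtP i j) => // /hr; rewrite eqr ltxx.
split.
- by apply: bajnok_labelled => //; case/andP: hp.
- exact: bajnok_symmetric.
- by exists (@zonal_basis R p _ r); apply: bajnok_basis.
by move=> E P basisE eigP i j; apply: bajnok_P_polynomial_block basisE eigP.
Qed.
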